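(* Let $G$ be a finite simple undirected graph with $m$ edges in which every vertex has degree at least $2$, and let $\chi(u,0)=\det(\mathbf{T}+u\mathbf{J})=d_0u^{2m}+d_1u^{2m-1}+\cdots+d_{2m}$ be its reduced Bartholdi zeta function. Then $d_2=(-1)^{m+1}\,|E(L(G))|$, where $|E(L(G))|$ is the number of edges of the line graph $L(G)$ of $G$.
   Context: Symmetric digraph: $\mathcal{D}(G)$ has vertex set $V(G)$ and arc set $\mathcal{E}(G)=\{(x,y),(y,x): xy\in E(G)\}$. For an arc $a=(x,y)$, $o(a)=x$, $t(a)=y$, $a^{-1}=(y,x)$. Label the $2m$ arcs $a_1,\dots,a_m,a_{m+1}=a_1^{-1},\dots,a_{2m}=a_m^{-1}$ (for an arbitrary orientation of the edges). The $2m\times2m$ matrices are: $\mathbf{T}_{ij}=1$ if $t(a_i)=o(a_j)$ and $a_j\ne a_i^{-1}$, and $0$ otherwise; $\mathbf{J}_{ij}=1$ if $a_j=a_i^{-1}$, and $0$ otherwise. The line graph $L(G)$ is the undirected graph whose vertices are the edges of $G$, two being adjacent if and only if the corresponding (distinct) edges of $G$ are incident to a common vertex. *)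

(* Defs.v *)
From mathcomp Require Import all_boot all_fingroup all_algebra.
Set Implicit Arguments.
Unset Strict Implicit.
Unset Printing Implicit Defensive.
Import GRing.Theory.
Local Open Scope ring_scope.

Record sgraph := SGraph {
  vertex :> finType;
  adj : rel vertex;
  adj_sym : symmetric adj;
  adj_irr : irreflexive adj
}.

Definition edges (G : sgraph) : {set {set G}} :=
  [set E : {set G} | [exists x, exists y, adj x y && (E == [set x; y])]].

Definition degree (G : sgraph) (x : G) : nat := #|[set y | adj x y]|.

Definition line_vertex (G : sgraph) := {E : {set G} | E \in edges G}.

Definition line_adj (G : sgraph) : rel (line_vertex G) :=
  fun E F => (E != F) && (val E :&: val F != set0).

Lemma line_adj_sym G : symmetric (@line_adj G).
Proof. by move=> E F; rewrite /line_adj eq_sym setIC. Qed.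

Lemma line_adj_irr G : irreflexive (@line_adj G).
Proof. by move=> E; rewrite /line_adj eqxx. Qed.

Definition line_graph (G : sgraph) : sgraph :=
  SGraph (@line_adj_sym G) (@line_adj_irr G).

Definition darc (G : sgraph) := {p : G * G | adj p.1 p.2}.

Definition org (G : sgraph) (a : darc G) : G := (val a).1.
Definition ter (G : sgraph) (a : darc G) : G := (val a).2.

Lemma arc_inv_subproof (G : sgraph) (a : darc G) : adj (ter a) (org a).
Proof. by rewrite adj_sym; exact: (valP a). Qed.

Definition arc_inv (G : sgraph) (a : darc G) : darc G :=
  exist (fun p : G * G => adj p.1 p.2) (ter a, org a) (arc_inv_subproof a).

(* a_1, ..., a_m is an arbitrary orientation of the edges, and a_(m+i) is the
   inverse of a_i. *)
Definition arc_labelling (G : sgraph)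
    (a : 'I_(#|edges G| + #|edges G|) -> darc G) : Prop :=
  bijective a /\
  forall i : 'I_#|edges G|, a (rshift _ i) = arc_inv (a (lshift _ i)).

Section Matrices.
Variables (G : sgraph) (n : nat) (a : 'I_n -> darc G).

Definition matT : 'M[int]_n :=
  \matrix_(i, j) ((ter (a i) == org (a j)) && (a j != arc_inv (a i)))%:R.

Definition matJ : 'M[int]_n := \matrix_(i, j) (a j == arc_inv (a i))%:R.

(* The indeterminate u is 'X. *)
Definition reduced_bartholdi : {poly int} :=
  \det (map_mx polyC matT + 'X *: map_mx polyC matJ).

(* Coefficients are numbered from the formal leading term u^n downwards, and
   are 0 past the constant term; without the guard the truncated subtraction
   would return the constant term again when n < k. *)
Definition bartholdi_coef (k : nat) : int :=
  if (k <= n)%N then reduced_bartholdi`_(n - k) else 0.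

Lemma reduced_bartholdiE :
  reduced_bartholdi = \sum_(k < n.+1) bartholdi_coef k *: 'X^(n - k).
Proof.
pose M := map_mx polyC matT + 'X *: map_mx polyC matJ.
have szM i j : (size (M i j) <= 2)%N.
  rewrite !mxE addrC mulrC size_MXaddC; case: ifP => // _.
  exact: leq_ltn_trans (size_polyC_leq1 _) _.
have szchi : (size reduced_bartholdi <= n.+1)%N.
  apply: (leq_trans (size_sum _ _ _)); apply/bigmax_leqP => s _.
  rewrite -signr_odd mulr_sign.
  suff szp : (size (\prod_(i < n) M i (s i))%R <= n.+1)%N.
    by case: ifP; rewrite ?size_polyN.
  apply: (leq_trans (size_poly_prod_leq _ _)).
  rewrite leq_subLR addnS ltnS [#|_|]card_ord addnn -mul2n mulnC.
  rewrite -[X in (_ <= X * _)%N]card_ord -sum_nat_const.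
  by apply: leq_sum => i _; apply: szM.
rewrite /bartholdi_coef; move: reduced_bartholdi szchi => p szp.
have {1}-> : p = \poly_(i < n.+1) p`_i.
  apply/polyP => k; rewrite coef_poly; case: ltnP => // le_nk.
  by rewrite nth_default // (leq_trans szp).
rewrite poly_def (reindex_inj rev_ord_inj) /=; apply: eq_bigr => k _.
by rewrite subSS -ltnS ltn_ord.
Qed.

End Matrices.

Lemma arc_labelling_exists (G : sgraph) :
  exists a : 'I_(#|edges G| + #|edges G|) -> darc G, arc_labelling a.
Proof.
have inv_neq (x : darc G) : arc_inv x != x.
  apply/eqP => /(congr1 (fun z => (val z).1)) /= eq_tx.
  by have := arc_inv_subproof x; rewrite eq_tx adj_irr.
pose ends (x : darc G) : {set G} := [set org x; ter x].
have ends_inv x : ends (arc_inv x) = ends x by rewrite /ends setUC.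
have ends_eq x y : ends x = ends y -> x = y \/ x = arc_inv y.
  case: x y => [[x1 x2] xP] [[y1 y2] yP]; rewrite /ends /org /ter /= => eq_xy.
  have ne : x1 != x2 by apply: contraTneq xP => ->; rewrite /= adj_irr.
  have /set2P x1y : x1 \in [set y1; y2] by rewrite -eq_xy set21.
  have /set2P x2y : x2 \in [set y1; y2] by rewrite -eq_xy set22.
  case: x1y x2y => [] e1 [] e2; try by rewrite e1 e2 eqxx in ne.
    by left; apply: val_inj; rewrite /= e1 e2.
  by right; apply: val_inj; rewrite /= e1 e2.
have ends_edge x : ends x \in edges G.
  rewrite inE; apply/existsP; exists (org x); apply/existsP; exists (ter x).
  by rewrite (valP x) eqxx.
have /fin_all_exists [f fE] (i : 'I_#|edges G|) :
    exists x, ends x = enum_val i.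
  have := enum_valP i; rewrite inE => /existsP[x /existsP[y /andP[xy /eqP ->]]].
  by exists (exist (fun p : G * G => adj p.1 p.2) (x, y) xy).
pose a (k : 'I_(#|edges G| + #|edges G|)) :=
  match split k with inl i => f i | inr i => arc_inv (f i) end.
have a_l i : a (lshift _ i) = f i.
  by rewrite /a -[lshift _ i]/(unsplit (inl i)) unsplitK.
have a_r i : a (rshift _ i) = arc_inv (f i).
  by rewrite /a -[rshift _ i]/(unsplit (inr i)) unsplitK.
exists a; split; last by move=> i; rewrite a_l a_r.
have inj_a : injective a.
  have inj_f i j : ends (f i) = ends (f j) -> i = j.
    by rewrite !fE => /enum_val_inj.
  move=> i j; case: (split_ordP i) (split_ordP j) => {}i -> [] {}j ->;
    rewrite ?a_l ?a_r => eq_a; have := congr1 ends eq_a;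
    rewrite ?ends_inv => /inj_f eq_ij; move: eq_a; rewrite eq_ij //.
  - by move/esym/eqP; rewrite (negPf (inv_neq _)).
  - by move/eqP; rewrite (negPf (inv_neq _)).
have surj_a x : exists k, a k = x.
  pose i := enum_rank_in (ends_edge x) (ends x).
  have eq_ends : ends x = ends (f i) by rewrite fE enum_rankK_in.
  have [->|->] := ends_eq _ _ eq_ends.
    by exists (lshift _ i).
  by exists (rshift _ i).
have /fin_all_exists [g gK] := surj_a.
by exists g => // k; apply: inj_a; rewrite gK.
Qed.

(* Main.v *)
Require Import Defs.
From mathcomp Require Import all_boot all_fingroup all_algebra.
Import GRing.Theory.
Local Open Scope ring_scope.
Set Implicit Arguments.
Unset Strict Implicit.

(** Reversing an arc permutes the arcs, so it permutes the rows of T + u J: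
    the row of an arc b becomes the row of its inverse.  After this
    permutation the entry at (b, c) is u when b = c, it is 1 when b and c are
    distinct arcs leaving the same vertex, and it is 0 otherwise.  Hence
    det (T + u J) is, up to the sign of the permutation, det (K + u I), where
    K is the 0-1 matrix of the relation of being distinct with the same origin
    ([reduced_bartholdi_same_org]).  The permutation exchanges the two halves
    of the labelling, so its sign is (-1)^m ([sign_swap_halves]).

    Since K has a zero diagonal, a permutation s contributes to det (K + u I) a
    monomial in u whose degree is the number of fixed points of s.  The
    coefficient of u^(2m-2) therefore collects exactly the transpositions, and
    it equals minus the sum of K i j * K j i over the unordered pairs i, j
    ([coef_det_second]), that is, minus the number of unordered pairs of
    distinct arcs with a common origin.

    Such a pair of arcs is the same thing as a pair of distinct edges with a
    common vertex.  In a simple graph distinct edges share at most one vertex,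
    and directing both edges away from it recovers the two arcs; so these pairs
    are counted by the edges of the line graph ([card_line_edges]). *)

(** * The second coefficient of det (K + u I) for K with zero diagonal *)

Lemma ord_lt_neq (n : nat) (i j : 'I_n) : (i < j)%N -> i != j.
Proof. by rewrite ltn_neqAle => /andP[]. Qed.

Definition moved (n : nat) (s : 'S_n) : {set 'I_n} := [set i | s i != i].

Lemma moved_tperm (n : nat) (i j : 'I_n) :
  i != j -> moved (tperm i j) = [set i; j].
Proof.
move=> ne_ij; apply/setP => k; rewrite !inE.
case: tpermP => [->|->|/eqP/negPf-> /eqP/negPf->];
  by rewrite ?eqxx ?orbT // eq_sym ne_ij.
Qed.

(** The set of moved points is stable under s, so its two elements must be
    exchanged.  Ordering the pair makes it the unique code of the
    transposition. *)
Lemma perm_moved2 (n : nat) (s : 'S_n) :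
  #|moved s| = 2 -> exists2 p : 'I_n * 'I_n, (p.1 < p.2)%N & s = tperm p.1 p.2.
Proof.
move/eqP/cards2P => [i [j [ne_ij mvE]]].
have mvP k : (s k != k) = (k == i) || (k == j).
  by have := congr1 (fun A : {set 'I_n} => k \in A) mvE; rewrite !inE.
have stable k : s k != k -> s (s k) != s k by apply: contra_neq => /perm_inj.
have si : s i = j.
  have mi : s i != i by rewrite mvP eqxx.
  by have := stable _ mi; rewrite mvP (negPf mi) /= => /eqP.
have sj : s j = i.
  have mj : s j != j by rewrite mvP eqxx orbT.
  by have := stable _ mj; rewrite mvP (negPf mj) orbF => /eqP.
have sE : s = tperm i j.
  apply/permP => k; case: tpermP => [->|->|/eqP ki /eqP kj] //.
  by apply/eqP; apply: contraTT isT; rewrite mvP (negPf ki) (negPf kj).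
have [lt_ij|lt_ji|/val_inj eq_ij] := ltngtP i j.
- by exists (i, j).
- by exists (j, i); rewrite // tpermC.
- by rewrite eq_ij eqxx in ne_ij.
Qed.

Lemma tperm_inj_lt (n : nat) :
  {in [pred p : 'I_n * 'I_n | (p.1 < p.2)%N] &,
    injective (fun p => tperm p.1 p.2)}.
Proof.
move=> [i j] [k l] /[!inE] /= lt_ij lt_kl eq_t.
have eqS : [set i; j] = [set k; l] by rewrite -!moved_tperm ?ord_lt_neq // eq_t.
have /set2P ik : i \in [set k; l] by rewrite -eqS set21.
have /set2P jk : j \in [set k; l] by rewrite -eqS set22.
case: ik jk lt_ij lt_kl => -> [] -> //; rewrite ?ltnn // => /ltnW.
by rewrite leqNgt => /negPf->.
Qed.

(** This is the sum of the principal 2-minors of K, which reduce to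
    - K i j * K j i because the diagonal of K vanishes. *)
Lemma coef_det_second (R : comNzRingType) (n : nat) (K : 'M[R]_n) :
  (1 < n)%N -> (forall i, K i i = 0) ->
  (\det (map_mx polyC K + 'X%:M))`_(n - 2) =
  - \sum_(p : 'I_n * 'I_n | (p.1 < p.2)%N) K p.1 p.2 * K p.2 p.1.
Proof.
move=> n_gt1 K0; rewrite coef_sum.
have termE (s : 'S_n) :
    \prod_i (map_mx polyC K + 'X%:M) i (s i) =
    (\prod_(i in moved s) K i (s i))%:P * 'X^(n - #|moved s|).
  rewrite (bigID (mem (moved s))) /= rmorph_prod /=; congr (_ * _).
    by apply: eq_bigr => i; rewrite !inE !mxE eq_sym => /negPf->; rewrite addr0.
  rewrite (eq_bigr (fun=> 'X)) => [|i].
    rewrite prodr_const; congr ('X^_).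
    have := cardC (moved s); rewrite card_ord => /(canRL (addKn _)) <-.
    exact: eq_card.
  by rewrite !inE !mxE negbK => /eqP->; rewrite K0 eqxx add0r.
rewrite (bigID (fun s : 'S_n => #|moved s| == 2)) /=.
rewrite [X in _ + X]big1 ?addr0; last first.
  move=> s mv2; rewrite termE -signr_odd mulr_sign.
  suff c0 : ((\prod_(i in moved s) K i (s i))%:P
             * 'X^(n - #|moved s|))`_(n - 2) = 0.
    by case: ifP; rewrite ?coefN c0 ?oppr0.
  rewrite coefCM coefXn; case: eqP; rewrite ?mulr0 // => eq_n.
  have le_mv : (#|moved s| <= n)%N.
    by rewrite -[n in (_ <= n)%N]card_ord max_card.
  by case/eqP: mv2; rewrite -[LHS](subKn le_mv) -eq_n subKn.
rewrite (eq_bigl [in [set tperm p.1 p.2 | p in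
    [pred p : 'I_n * 'I_n | (p.1 < p.2)%N]]]).
  rewrite big_imset /=; last exact: tperm_inj_lt.
  rewrite -sumrN; apply: eq_bigr => -[i j] /[!inE] /= lt_ij.
  have ne_ij := ord_lt_neq lt_ij.
  rewrite termE odd_tperm ne_ij expr1 mulN1r coefN coefCM moved_tperm //.
  rewrite cards2 ne_ij coefXn eqxx mulr1 big_setU1 ?inE //= big_set1.
  by rewrite tpermL tpermR.
move=> s; apply/eqP/imsetP => [/perm_moved2[p p_lt ->]|[p]].
  by exists p.
by rewrite inE => p_lt ->; rewrite moved_tperm ?cards2 (ord_lt_neq p_lt).
Qed.

(** * Reversing the arcs *)

(** The swap matrix is a product of three block-triangular matrices, as a swap
    of two variables is a sequence of three additions or subtractions up to a
    change of sign; the middle factor alone has a nontrivial determinant. *)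
Lemma det_block_swap (R : comNzRingType) (m : nat) :
  \det (block_mx 0 1%:M 1%:M 0 : 'M[R]_(m + m)) = (-1) ^+ m.
Proof.
have -> : block_mx 0 1%:M 1%:M 0 =
    block_mx 1%:M 1%:M 0 1%:M *m block_mx (- 1%:M) 0 1%:M 1%:M
      *m block_mx 1%:M (- 1%:M) 0 1%:M :> 'M[R]_(m + m).
  rewrite !mulmx_block !(mul1mx, mulmx1, mul0mx, mulmx0, addr0, add0r).
  by rewrite addNr mul0mx add0r.
rewrite !det_mulmx !det_ublock det_lblock !det1 !mulr1 mul1r.
by rewrite -scaleN1r detZ det1 mulr1.
Qed.

Lemma sign_swap_halves (R : comNzRingType) (m : nat) (s : 'S_(m + m)) :
  (forall i, s (lshift m i) = rshift m i) ->
  (forall i, s (rshift m i) = lshift m i) ->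
  (-1) ^+ s = (-1) ^+ m :> R.
Proof.
move=> sl sr; rewrite -det_perm -det_block_swap; congr (\det _).
apply/matrixP => i j; case: (split_ordP i) (split_ordP j) => {}i -> [] {}j ->;
  rewrite !(block_mxEul, block_mxEur, block_mxEdl, block_mxEdr) !mxE ?sl ?sr.
all: by rewrite ?(eq_lshift, eq_rshift, eq_lrshift, eq_rlshift).
Qed.

Lemma arc_invK (G : sgraph) : involutive (@arc_inv G).
Proof. by case=> [[x y] xy]; apply: val_inj. Qed.

Definition same_org (G : sgraph) (n : nat) (a : 'I_n -> darc G) : 'M[int]_n :=
  \matrix_(i, j) ((org (a i) == org (a j)) && (i != j))%:R.

(** The row of T + u J indexed by an arc is the row of K + u I indexed by the
    inverse arc: the terminus of an arc is the origin of its inverse, and the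
    exclusion of backtracking in T becomes the vanishing diagonal of K. *)
Lemma reduced_bartholdi_same_org (G : sgraph)
    (a : 'I_(#|edges G| + #|edges G|) -> darc G) :
  arc_labelling a ->
  reduced_bartholdi a =
  (-1) ^+ #|edges G| * \det (map_mx polyC (same_org a) + 'X%:M).
Proof.
move=> [[g aK gK] a_inv].
have s_inj : injective (fun i => g (arc_inv (a i))).
  exact: inj_comp (can_inj gK) (inj_comp (can_inj (@arc_invK G)) (can_inj aK)).
pose s := perm s_inj.
have a_s i : a (s i) = arc_inv (a i) by rewrite permE gK.
rewrite -(@sign_swap_halves _ _ s) => [|i|i]; last 2 first.
- by apply: (can_inj aK); rewrite a_s a_inv.
- by apply: (can_inj aK); rewrite a_s a_inv arc_invK.
rewrite -det_perm -det_mulmx -row_permE; congr (\det _).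
apply/matrixP => i j; rewrite !mxE a_s -(inj_eq (can_inj aK) (s i)) a_s.
by rewrite [arc_inv _ == _]eq_sym (rmorph_nat _ (a j == _)) mulr_natr.
Qed.

(** * Pairs of arcs with a common origin and edges of the line graph *)

Lemma arc_edge_subproof (G : sgraph) (b : darc G) :
  [set org b; ter b] \in edges G.
Proof.
rewrite inE; apply/existsP; exists (org b); apply/existsP; exists (ter b).
by rewrite (valP b) eqxx.
Qed.

Definition arc_edge (G : sgraph) (b : darc G) : line_vertex G :=
  exist _ [set org b; ter b] (arc_edge_subproof b).

Lemma org_neq_ter (G : sgraph) (b : darc G) : org b != ter b.
Proof.
by apply/eqP => eq_b; have := valP b; rewrite -/(org b) -/(ter b) eq_b adj_irr.
Qed.

Lemma arc_edge_inj (G : sgraph) (b c : darc G) :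
  org b = org c -> arc_edge b = arc_edge c -> b = c.
Proof.
move=> eq_o /(congr1 val) /= eqE.
have /set2P[eq_t|eq_t] : ter b \in [set org c; ter c] by rewrite -eqE set22.
  by have := org_neq_ter b; rewrite eq_t eq_o eqxx.
apply: val_inj; move: eq_o eq_t; rewrite /org /ter.
by case: (val b) (val c) => [? ?] [? ?] /= -> ->.
Qed.

(** A second common vertex would be the terminus of both arcs, which would then
    coincide. *)
Lemma arc_edge_meet (G : sgraph) (b c : darc G) (x : G) :
  org b = org c -> b != c ->
  x \in val (arc_edge b) -> x \in val (arc_edge c) -> x = org b.
Proof.
move=> eq_o ne_bc /= /set2P[//|xb] /set2P[->//|xc].
case/eqP: ne_bc; apply: arc_edge_inj => //; apply: val_inj.
by rewrite /= eq_o -xb xc.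
Qed.

Lemma arc_at (G : sgraph) (E : line_vertex G) (x : G) :
  x \in val E -> exists2 b, org b = x & arc_edge b = E.
Proof.
move=> xE; have := valP E; rewrite /= inE.
move=> /existsP[y /existsP[z /andP[yz /eqP E_yz]]].
pose b : darc G := exist (fun p : G * G => adj p.1 p.2) (y, z) yz.
have bE : arc_edge b = E by apply: val_inj; rewrite /= E_yz.
move: xE; rewrite /= E_yz => /set2P[->|->].
  by exists b.
by exists (arc_inv b) => //; rewrite -bE; apply: val_inj; rewrite /= setUC.
Qed.

Definition org_pairs (G : sgraph) (n : nat) (a : 'I_n -> darc G) :
    {set 'I_n * 'I_n} :=
  [set p : 'I_n * 'I_n | (p.1 < p.2)%N & org (a p.1) == org (a p.2)].

(** Sending two arcs to the pair of their edges is injective on [org_pairs]: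
    the common origin is the only vertex shared by the two edges, and an edge
    together with an origin determines an arc.  It is onto the edges of the
    line graph, because two edges that meet can both be directed away from a
    common vertex. *)
Lemma card_line_edges (G : sgraph) (n : nat) (a : 'I_n -> darc G) :
  bijective a -> #|edges (line_graph G)| = #|org_pairs a|.
Proof.
move=> [g aK gK]; have a_inj := can_inj aK.
pose f (p : 'I_n * 'I_n) : {set line_graph G} :=
  [set arc_edge (a p.1); arc_edge (a p.2)].
have ne_a (i j : 'I_n) : (i < j)%N -> a i != a j.
  by rewrite (inj_eq a_inj); apply: ord_lt_neq.
rewrite -(card_in_imset (f := f)); last first.
  move=> [i j] [k l] /[!inE] /= /andP[lt_ij /eqP o_ij] /andP[lt_kl /eqP o_kl] eq_f.
  have org_eq : org (a i) = org (a k).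
    have sub : org (a i) \in val (arc_edge (a k)) /\
               org (a i) \in val (arc_edge (a l)).
      have inI u : u \in f (i, j) -> org (a i) \in val u.
        by case/set2P => -> /=; rewrite ?o_ij set21.
      by split; apply: inI; rewrite eq_f ?set21 ?set22.
    by case: sub; apply: arc_edge_meet => //; apply: ne_a.
  have edge_inj u v : org (a u) = org (a v) ->
      arc_edge (a u) = arc_edge (a v) -> u = v.
    by move=> o_uv e_uv; apply: a_inj; apply: arc_edge_inj.
  have /set2P ik : arc_edge (a i) \in f (k, l) by rewrite -eq_f set21.
  have /set2P jk : arc_edge (a j) \in f (k, l) by rewrite -eq_f set22.
  have {}ik : i = k \/ i = l.
    by case: ik => e; [left|right]; apply: edge_inj e; rewrite ?org_eq.
  have {}jk : j = k \/ j = l.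
    by case: jk => e; [left|right]; apply: edge_inj e; rewrite -o_ij org_eq.
  (* The remaining case i = l, j = k contradicts i < j and k < l. *)
  case: ik jk lt_ij lt_kl => -> [] -> //; rewrite ?ltnn // => /ltnW.
  by rewrite leqNgt => /negPf->.
apply: eq_card => S; apply/idP/imsetP => [|[[i j]]]; last first.
  rewrite inE /= => /andP[lt_ij /eqP o_ij] ->; rewrite inE.
  apply/existsP; exists (arc_edge (a i)).
  apply/existsP; exists (arc_edge (a j)).
  rewrite eqxx andbT /= /line_adj; apply/andP; split.
    by apply: contraNneq (ne_a _ _ lt_ij) => /(arc_edge_inj o_ij) ->.
  by apply/set0Pn; exists (org (a i)); rewrite inE /= set21 o_ij set21.
rewrite inE => /existsP[E /existsP[F /andP[/andP[ne_EF meet] /eqP->]]].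
case/set0Pn: meet => x /setIP[/arc_at[b bx bE] /arc_at[c cx cF]].
have [lt_bc|lt_cb|/val_inj/(can_inj gK) eq_bc] := ltngtP (g b) (g c).
- by exists (g b, g c); rewrite /f ?inE /= !gK ?bE ?cF // bx cx lt_bc /=.
- by exists (g c, g b); rewrite /f ?inE /= !gK ?bE ?cF 1?setUC // bx cx lt_cb /=.
- by rewrite -bE -cF eq_bc eqxx in ne_EF.
Qed.

Lemma coef_det_same_org (G : sgraph) (n : nat) (a : 'I_n -> darc G) :
  (1 < n)%N ->
  (\det (map_mx polyC (same_org a) + 'X%:M))`_(n - 2) = - #|org_pairs a|%:R.
Proof.
move=> n_gt1; rewrite coef_det_second // => [|i]; last by rewrite mxE !eqxx.
congr (- _); rewrite -[#|org_pairs a|]sum1_card natr_sum.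
rewrite big_mkcond [RHS]big_mkcond /=; apply: eq_bigr => -[i j] _.
rewrite !inE !mxE /=; case: ltnP => //= lt_ij.
rewrite [j == i]eq_sym (ord_lt_neq lt_ij) [org (a j) == _]eq_sym !andbT.
by case: eqP.
Qed.

Unset Implicit Arguments.

Theorem lemma4p2 (G : sgraph)
    (a : 'I_(#|edges G| + #|edges G|) -> darc G) :
  (forall x : G, (2 <= degree x)%N) ->
  arc_labelling a ->
  bartholdi_coef a 2 = (-1) ^+ (#|edges G|).+1 * (#|edges (line_graph G)|)%:R.
Proof.
move=> _ labelled; have [a_bij _] := labelled.
rewrite (card_line_edges a_bij) /bartholdi_coef.
case: ifP => [n_ge2|/negbT n_lt2]; last first.
  (* With fewer than two arcs there is no pair i < j, so both sides vanish. *)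
  rewrite (_ : org_pairs a = set0) ?cards0 ?mulr0 //.
  apply/setP => -[i j]; rewrite !inE /=; apply/negbTE/nandP; left.
  move: n_lt2; apply: contra => lt_ij.
  exact: leq_ltn_trans (leq_ltn_trans (leq0n i) lt_ij) (ltn_ord j).
rewrite (reduced_bartholdi_same_org labelled) exprSr mulrN1 mulNr -mulrN.
rewrite -signr_odd -[in RHS]signr_odd !mulr_sign.
by case: ifP; rewrite ?coefN coef_det_same_org.
Qed.
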